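(* Let $p>3$ be a prime that splits completely in $K=\mathbb{Q}(\omega,3^{1/6})$, where $\omega=e^{\pi i/6}$, and let $a_1,a_2,a_3\in\{1,\dots,p\}$ be integers with $P_1(a_1,a_2,a_3)\equiv-1$, $P_2(a_1,a_2,a_3)\equiv3$, $P_3(a_1,a_2,a_3)\equiv-1$, $P_4(a_1,a_2,a_3)\equiv-1\pmod p$. Then there exist $\Theta_1,\Theta_2,\Theta_3>0$ such that the following holds. Let $L$ be a positive integer, let $\Lambda\subseteq\{0,1,\dots,L-1\}$ contain no solutions $(w,x,y,z)\in\Lambda^4$, other than those with $w=x=y=z$, to $P_1(a_1,a_2,a_3)w+P_2(a_1,a_2,a_3)x+P_3(a_1,a_2,a_3)y+P_4(a_1,a_2,a_3)z=0$, and let $\psi\in\mathbb{R}$. For $j\in\Lambda$ let $I_j=\big[\frac{j}{\Theta_1L},\frac{j}{\Theta_1L}+\frac{1}{\Theta_1^2L}\big)\subseteq\mathbb{R}/\mathbb{Z}$ and $B=\bigcup_{j\in\Lambda}I_j$. Let $n,d\in\mathbb{Z}$ and $w=\psi n^2$, $x=\psi(n+a_1d)^2$, $y=\psi(n+a_2d)^2$, $z=\psi(n+a_3d)^2$. If $w,x,y,z\pmod1$ all lie in $B$, then $\|\Theta_2\psi nd\|_{\mathbb{R}/\mathbb{Z}}<\Theta_3/L$.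
   Context: $P_1(X,Y,Z)=(X-Y)(Y-Z)(Z-X)$, $P_2(X,Y,Z)=YZ(Y-Z)$, $P_3(X,Y,Z)=ZX(Z-X)$, $P_4(X,Y,Z)=XY(X-Y)$. $\|t\|_{\mathbb{R}/\mathbb{Z}}$ denotes the distance from $t\in\mathbb{R}$ to the nearest integer. *)

(* Defs.v *)
From HB Require Import structures.
From mathcomp Require Import all_boot all_order all_algebra all_field.
From mathcomp Require Import boolp classical_sets set_interval reals.

Set Implicit Arguments.
Unset Strict Implicit.
Unset Printing Implicit Defensive.

Import Order.TTheory GRing.Theory Num.Theory.
Local Open Scope ring_scope.
Local Open Scope classical_set_scope.

Definition P1 (X Y Z : int) : int := (X - Y) * (Y - Z) * (Z - X).
Definition P2 (X Y Z : int) : int := Y * Z * (Y - Z).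
Definition P3 (X Y Z : int) : int := Z * X * (Z - X).
Definition P4 (X Y Z : int) : int := X * Y * (X - Y).

Section RingOfIntegers.
Variable K : fieldExtType rat.

Definition alg_integer : pred K :=
  fun x => `[< integralOver (intr : int -> K) x >].

Lemma alg_integer_subring : subring_closed alg_integer.
Proof.
split=> [|x y /asboolP xZ /asboolP yZ|x y /asboolP xZ /asboolP yZ];
  apply/asboolP.
- exact: integral1.
- exact: integral_sub.
- exact: integral_mul.
Qed.

HB.instance Definition _ :=
  GRing.isSubringClosed.Build K alg_integer alg_integer_subring.

Record ring_of_integers := RingOfIntegers {
  int_val :> K;
  _ : alg_integer int_val
}.

HB.instance Definition _ := [isSub for int_val].
HB.instance Definition _ := [Choice of ring_of_integers by <:].
HB.instance Definition _ :=
  [SubChoice_isSubComNzRing of ring_of_integers by <:].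

End RingOfIntegers.

Section Ideals.
Variable A : comNzRingType.

(* [idealr_closed] already requires the ideal to be proper. *)
Definition prime_ideal (I : set A) : Prop :=
  idealr_closed (mem I) /\ prime_idealr_closed (mem I).

Definition principal_ideal (a : A) : set A := [set a * x | x in [set: A]].

Definition ideal_mul (I J : set A) : set A :=
  [set z | exists (n : nat) (x y : 'I_n -> A),
     (forall i, I (x i) /\ J (y i)) /\ z = \sum_(i < n) x i * y i].

End Ideals.

(* p O_K is the product of [K : Q] pairwise distinct prime ideals of O_K. *)
Definition splits_completely (p : nat) (K : fieldExtType rat) : Prop :=
  exists Q : 'I_(\dim {:K}) -> set (ring_of_integers K),
    [/\ injective Q,
        forall i, prime_ideal (Q i)
      & principal_ideal p%:R =
          \big[@ideal_mul (ring_of_integers K)/setT]_i Q i].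

(* e^(pi i / 6) = cos (pi / 6) + i sin (pi / 6) *)
Definition omega : algC := (sqrtC 3%:R + 'i) / 2%:R.

(* The number field with a complex embedding in which it is generated over Q
   by omega and the positive real sixth root of 3. *)
Definition field_K : fieldExtType rat :=
  tag (num_field_exists [:: omega; 6.-root (3%:R : algC)]).

Section Circle.
Variable R : realType.

Definition norm_RZ (t : R) : R :=
  inf [set `|t - k%:~R| | k in [set: int]].

(* A subset of R/Z is given as the image of a set A of real representatives:
   this says that the class of t modulo 1 lies in that image. *)
Definition mod1_in (t : R) (A : set R) : Prop :=
  exists k : int, A (t + k%:~R).

Definition I_ (Theta1 : R) (L j : nat) : set R :=
  `[j%:R / (Theta1 * L%:R),
    j%:R / (Theta1 * L%:R) + (Theta1 ^+ 2 * L%:R)^-1[.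

Definition B_ (Theta1 : R) (L : nat) (Lambda : {set 'I_L}) : set R :=
  \bigcup_(j in [set` Lambda]) I_ Theta1 L j.

End Circle.

(* Main.v *)
(* The Pi(a1, a2, a3) are, up to a common factor, the weights of the third
   divided difference at 0, a1, a2, a3, which kills quadratics, so
   P1 w + P2 x + P3 y + P4 z = 0.  Write each of w, x, y, z as an integer plus
   j / (Theta1 L) plus an error below 1 / (Theta1^2 L).  For Theta1 large,
   the integer parts and then the numerators j satisfy the same relation, so all
   four j coincide.  Hence x - w and y - w are within 1 / (Theta1^2 L) of
   integers, and a2^2 (x - w) - a1^2 (y - w) = 2 a1 a2 (a2 - a1) psi n d. *)

Require Import Defs.
From mathcomp Require Import all_boot all_order all_algebra all_field.
From mathcomp Require Import boolp classical_sets set_interval reals.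
From mathcomp Require Import ring lra.

Import Order.TTheory GRing.Theory Num.Theory.
Local Open Scope ring_scope.

Lemma norm_RZ_le (R : realType) (t : R) (k : int) :
  norm_RZ t <= `|t - k%:~R|.
Proof.
by apply: ge_inf; [exists 0 => _ [m _ <-]; exact: normr_ge0 | exists k].
Qed.

Lemma norm_intr_lt1 (R : realType) (m : int) : `|m%:~R : R| < 1 -> m = 0.
Proof. by rewrite -intr_norm ltrz1; case: m => [[]|]. Qed.

Lemma P_sqr (a b c n d : int) :
  P1 a b c * n ^+ 2 + P2 a b c * (n + a * d) ^+ 2
    + P3 a b c * (n + b * d) ^+ 2 + P4 a b c * (n + c * d) ^+ 2 = 0.
Proof. by rewrite /P1 /P2 /P3 /P4; ring. Qed.

Lemma mod1_in_B (R : realType) (T : R) (L : nat) (Lambda : {set 'I_L}) (t : R) :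
  mod1_in t (B_ T Lambda) ->
  exists (k : int) (j : 'I_L) (e : R),
    [/\ j \in Lambda, 0 <= e < (T ^+ 2 * L%:R)^-1 &
        t = k%:~R + j%:R / (T * L%:R) + e].
Proof.
case=> k [j /= jL]; rewrite /I_ /= in_itv /= => /andP[lo hi].
exists (- k), j, (t + k%:~R - j%:R / (T * L%:R)); split => //.
- by apply/andP; split; lra.
- by rewrite intrN; ring.
Qed.

(** Serves twice: for the numerators, with [c] equal to [L], and for the errors, with [c] equal to
    [1 / (T^2 L)]. *)
Lemma norm_lincomb4_le (R : realType) (q1 q2 q3 q4 x1 x2 x3 x4 c : R) :
  0 <= x1 <= c -> 0 <= x2 <= c -> 0 <= x3 <= c -> 0 <= x4 <= c ->
  `|q1 * x1 + q2 * x2 + q3 * x3 + q4 * x4|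
    <= (`|q1| + `|q2| + `|q3| + `|q4|) * c.
Proof.
have le1 (q x : R) : 0 <= x <= c -> `|q * x| <= `|q| * c.
  by case/andP=> x0 xc; rewrite normrM (ger0_norm x0) ler_wpM2l.
move=> /(le1 q1) h1 /(le1 q2) h2 /(le1 q3) h3 /(le1 q4) h4.
rewrite !mulrDl; do 3! [apply: le_trans (ler_normD _ _) _; apply: lerD => //].
Qed.

(** The choice of [T] gives [S / T < 1/2], which bounds both [J / (T L)] and [E]. So the integer [M]
    has absolute value below 1 and vanishes. Then [J = - E T L] has absolute value at most [S / T],
    and vanishes too. *)
Lemma small_relation_lifts (R : realType) (S T E : R) (L : nat) (M J : int) :
  0 <= S -> T = 1 + 2 * S -> (0 < L)%N ->
  `|J%:~R : R| <= S * L%:R -> `|E| <= S * (T ^+ 2 * L%:R)^-1 ->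
  M%:~R + J%:~R / (T * L%:R) + E = 0 -> J = 0.
Proof.
move=> S0 TE L0 JS ES eq0.
have T1 : 1 <= T by lra.
have T0 : 0 < T by lra.
have L1 : 1 <= L%:R :> R by rewrite ler1n.
have Lp : 0 < L%:R :> R by rewrite ltr0n.
have TL0 : 0 < T * L%:R by rewrite mulr_gt0.
have ST : S / T < 1 / 2 by rewrite ltr_pdivrMr //; lra.
have ETL : `|E| * (T * L%:R) <= S / T.
  rewrite -ler_pdivlMr //; apply: le_trans ES _.
  suff -> : S / T / (T * L%:R) = S / (T ^+ 2 * L%:R) by [].
  by field; rewrite ?(gt_eqF T0) ?(gt_eqF Lp).
have E2 : `|E| < 1 / 2.
  apply: le_lt_trans ST; apply: le_trans ETL.
  by rewrite ler_peMr // mulr_ege1.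
have J2 : `|J%:~R / (T * L%:R)| < 1 / 2.
  rewrite normrM normfV (gtr0_norm TL0); apply: le_lt_trans ST.
  rewrite ler_pdivrMr //; suff -> : S / T * (T * L%:R) = S * L%:R by [].
  by field; rewrite (gt_eqF T0).
have M0 : M = 0.
  apply: (@norm_intr_lt1 R).
  have -> : M%:~R = - (J%:~R / (T * L%:R) + E) by lra.
  by rewrite normrN; apply: le_lt_trans (ler_normD _ _) _; lra.
apply: (@norm_intr_lt1 R).
have -> : J%:~R = - (E * (T * L%:R)).
  have : J%:~R / (T * L%:R) = - E by move: eq0; rewrite M0; lra.
  by move/(congr1 (fun u => u * (T * L%:R))); rewrite divfK ?gt_eqF // mulNr.
by rewrite normrN normrM (gtr0_norm TL0); lra.
Qed.

Theorem lemma5p4 (R : realType) (p : nat) (a1 a2 a3 : nat)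
    (p_prime : prime p) (p_gt3 : (3 < p)%N)
    (p_split : splits_completely p field_K)
    (a1_range : (1 <= a1 <= p)%N)
    (a2_range : (1 <= a2 <= p)%N)
    (a3_range : (1 <= a3 <= p)%N)
    (P1_mod : (P1 a1%:Z a2%:Z a3%:Z = - 1 %[mod p%:Z])%Z)
    (P2_mod : (P2 a1%:Z a2%:Z a3%:Z = 3 %[mod p%:Z])%Z)
    (P3_mod : (P3 a1%:Z a2%:Z a3%:Z = - 1 %[mod p%:Z])%Z)
    (P4_mod : (P4 a1%:Z a2%:Z a3%:Z = - 1 %[mod p%:Z])%Z) :
  exists Theta1 Theta2 Theta3 : R,
    [/\ 0 < Theta1, 0 < Theta2, 0 < Theta3 &
      forall (L : nat) (Lambda : {set 'I_L}) (psi : R),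
        (0 < L)%N ->
        (forall w x y z : 'I_L,
           w \in Lambda -> x \in Lambda -> y \in Lambda -> z \in Lambda ->
           P1 a1%:Z a2%:Z a3%:Z * (w : nat)%:Z
             + P2 a1%:Z a2%:Z a3%:Z * (x : nat)%:Z
             + P3 a1%:Z a2%:Z a3%:Z * (y : nat)%:Z
             + P4 a1%:Z a2%:Z a3%:Z * (z : nat)%:Z = 0 ->
           [/\ w = x, x = y & y = z]) ->
        forall n d : int,
          let B := B_ Theta1 Lambda in
          let w := psi * n%:~R ^+ 2 in
          let x := psi * (n + a1%:Z * d)%:~R ^+ 2 in
          let y := psi * (n + a2%:Z * d)%:~R ^+ 2 in
          let z := psi * (n + a3%:Z * d)%:~R ^+ 2 in
          mod1_in w B -> mod1_in x B -> mod1_in y B -> mod1_in z B ->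
          norm_RZ (Theta2 * psi * n%:~R * d%:~R) < Theta3 / L%:R].
Proof.
set a := a1%:Z in P1_mod P2_mod P3_mod P4_mod *.
set b := a2%:Z in P1_mod P2_mod P3_mod P4_mod *.
set c := a3%:Z in P1_mod P2_mod P3_mod P4_mod *.
set q1 := P1 a b c; set q2 := P2 a b c; set q3 := P3 a b c; set q4 := P4 a b c.
(* Positivity of [Theta2 = 2 |q4|] rests on this; [q4] is -1 modulo [p]. *)
have q4_neq0 : q4 != 0.
  apply/eqP => q40; move: P4_mod; rewrite -/q4 q40 => /eqP.
  by rewrite eqz_mod_dvd opprK add0r dvdz1 /= gtn_eqF // prime_gt1.
pose S : R := `|q1%:~R| + `|q2%:~R| + `|q3%:~R| + `|q4%:~R|.
have S0 : 0 <= S by rewrite !addr_ge0.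
pose T : R := 1 + 2 * S.
have T1 : 1 <= T by rewrite /T; lra.
(* The absolute value is there because [q4 = a b (a - b)] may be negative. [Theta3] is the sum of
   the absolute coefficients of [y - w] and [x - w] in [ab_comb]. *)
exists T, (2 * `|q4%:~R|), (a%:~R ^+ 2 + b%:~R ^+ 2); split.
- by lra.
- by rewrite mulr_gt0 // normr_gt0 intr_eq0.
- by rewrite ltr_wpDl ?sqr_ge0 // exprn_gt0 // ltr0z; case/andP: a2_range.
move=> L Lambda psi L0 sol_free n d B w x y z.
move=> /mod1_in_B[kw [jw [ew [jwL ew_itv wE]]]].
move=> /mod1_in_B[kx [jx [ex [jxL ex_itv xE]]]].
move=> /mod1_in_B[ky [jy [ey [jyL ey_itv yE]]]].
move=> /mod1_in_B[kz [jz [ez [jzL ez_itv zE]]]].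
have relR : q1%:~R * w + q2%:~R * x + q3%:~R * y + q4%:~R * z = 0 :> R.
  have /(congr1 (fun m : int => psi * m%:~R)) := P_sqr a b c n d.
  rewrite mulr0 => <-; rewrite -/q1 -/q2 -/q3 -/q4 /w /x /y /z; ring.
have lt_le (e : R) : 0 <= e < (T ^+ 2 * L%:R)^-1 ->
    0 <= e <= (T ^+ 2 * L%:R)^-1.
  by case/andP=> -> /ltW.
have ordb (j : 'I_L) : 0 <= (j%:R : R) <= L%:R.
  by rewrite ler0n ler_nat ltnW.
pose J := q1 * (jw : nat)%:Z + q2 * (jx : nat)%:Z + q3 * (jy : nat)%:Z
  + q4 * (jz : nat)%:Z.
have J0 : J = 0.
  apply: (@small_relation_lifts R S T
    (q1%:~R * ew + q2%:~R * ex + q3%:~R * ey + q4%:~R * ez) L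
    (q1 * kw + q2 * kx + q3 * ky + q4 * kz)) => //.
  - suff -> : J%:~R = q1%:~R * jw%:R + q2%:~R * jx%:R + q3%:~R * jy%:R
        + q4%:~R * jz%:R :> R by exact: norm_lincomb4_le.
    by rewrite /J; ring.
  - by rewrite /S; apply: norm_lincomb4_le; exact: lt_le.
  - rewrite -[RHS]relR wE xE yE zE /J; ring.
have [jwx jxy _] := sol_free _ _ _ _ jwL jxL jyL jzL J0.
(* The weights [a^2] and [b^2] cancel the [d^2] terms of [y - w] and [x - w]; this order of
   subtraction makes the coefficient exactly [2 q4]. *)
have ab_comb : 2 * q4%:~R * psi * n%:~R * d%:~R
    = a%:~R ^+ 2 * (y - w) - b%:~R ^+ 2 * (x - w) :> R.
  by rewrite /q4 /P4 /w /x /y; ring.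
(* The same combination of the integer parts. Equal numerators cancel, so only differences of errors
   remain. *)
pose k := a ^+ 2 * (ky - kw) - b ^+ 2 * (kx - kw).
have close : `|2 * q4%:~R * psi * n%:~R * d%:~R - k%:~R|
    < (a%:~R ^+ 2 + b%:~R ^+ 2) / L%:R :> R.
  have -> : 2 * q4%:~R * psi * n%:~R * d%:~R - k%:~R
      = a%:~R ^+ 2 * (ey - ew) - b%:~R ^+ 2 * (ex - ew) :> R.
    by rewrite ab_comb yE xE wE jwx jxy /k; ring.
  have L1 : 0 < L%:R :> R by rewrite ltr0n.
  have dL : (T ^+ 2 * L%:R)^-1 <= L%:R^-1.
    by rewrite lef_pV2 ?posrE ?mulr_gt0 ?exprn_gt0 ?ler_peMl
      ?exprn_ege1 //; lra.
  (* Two errors in the same half-open interval differ by strictly less than its length, which is at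
     most [1 / L]. *)
  have ey_ew : `|ey - ew| < L%:R^-1 by rewrite ltr_norml; apply/andP; lra.
  have ex_ew : `|ex - ew| < L%:R^-1 by rewrite ltr_norml; apply/andP; lra.
  apply: le_lt_trans (ler_normB _ _) _.
  rewrite (normrM (_ ^+ 2)) (normrM (b%:~R ^+ 2)).
  rewrite !(ger0_norm (sqr_ge0 _)) mulrDl.
  by apply: ltrD; rewrite ltr_pM2l // exprn_gt0 // ltr0z;
    [case/andP: a1_range | case/andP: a2_range].
(* For negative [q4] the quantity changes sign, and [- k] is the integer close to it. *)
case: (ger0P (q4%:~R : R)) => _.
  by apply: le_lt_trans (norm_RZ_le _ _ k) _.
apply: le_lt_trans (norm_RZ_le _ _ (- k)) _.
suff -> : 2 * - q4%:~R * psi * n%:~R * d%:~R - (- k)%:~R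
    = - (2 * q4%:~R * psi * n%:~R * d%:~R - k%:~R) :> R by rewrite normrN.
by rewrite intrN; ring.
Qed.
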